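(* Let $\mathsf{Sys}^{\mathsf{ef}}$ be the category of nontrivial dynamical systems with embedding-factor pairs as morphisms. The category $\mathsf{Sys}^{\mathsf{ef}}$ is equivalent to the following category $\mathsf{dynAlg}$ of ''dynamic algebraic lattices''. Objects: pairs $(A,\alpha)$ where $A$ is an object of $\mathsf{bAlg}^{\mathsf{c}}$ and $\alpha:A\to A$ is a morphism of $\mathsf{bAlg}^{\mathsf{c}}$. Morphisms: pairs $(\epsilon,\pi):(A,\alpha)\to(B,\beta)$ of morphisms $\epsilon:A\to B$ and $\pi:B\to A$ in $\mathsf{bAlg}^{\mathsf{c}}$ such that (1) $\pi$ preserves co-atoms (if $b$ is a co-atom in $B$, then $\pi(b)$ is a co-atom in $A$); (2) $\pi\circ\epsilon=\mathrm{id}_A$; (3) $\epsilon\circ\pi\leq\mathrm{id}_B$; (4) $\pi\circ\beta\circ\epsilon\leq\alpha$; (5) $\alpha\circ\pi\leq\pi\circ\beta$. The equivalence is given by the functor that sends a system $(X,T)$ to $(\mathsf{F}(X),\mathsf{F}(T))$ and an ef-pair $(e,f):(X,T)\to(Y,S)$ to $(\mathsf{F}(e),\mathsf{F}(f))$.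
   Context: Multifunctions. A multifunction $F:X\rightrightarrows Y$ assigns to each $x\in X$ a subset $F(x)\subseteq Y$; write $x\xrightarrow{F}y$ for $y\in F(x)$ and $F[A]=\bigcup_{x\in A}F(x)$; composition is $(G\circ F)(x)=G[F(x)]$; functions are identified with singleton-valued multifunctions. $F$ is total if every $F(x)\neq\emptyset$; partition-injective if $F(x)\cap F(x')=\emptyset$ for $x\neq x'$ and every $y\in Y$ lies in some $F(x)$; closed-valued if every $F(x)$ is closed; upper-hemicontinuous if for every $x$ and open $V\supseteq F(x)$ there is an open $U\ni x$ with $F(x')\subseteq V$ for all $x'\in U$. Dynamical systems. A dynamical system is a pair $(X,T)$ with $X$ a zero-dimensional (having a basis of clopen sets), second-countable, compact Hausdorff space and $T:X\rightrightarrows X$ a closed-valued, upper-hemicontinuous multifunction. It is nontrivial if $x\xrightarrow{T}x'$ for some $x,x'\in X$. Morphisms of systems. A system morphism $\varphi:(X,T)\to(Y,S)$ is a closed-valued, upper-hemicontinuous multifunction $\varphi:X\rightrightarrows Y$ such that (i) if $x\xrightarrow{T}x'$, there are $y,y'$ with $x\xrightarrow{\varphi}y$, $x'\xrightarrow{\varphi}y'$, $y\xrightarrow{S}y'$; (ii) if $y\xrightarrow{S}y'$, there are $x,x'$ with $x\xrightarrow{\varphi}y$, $x'\xrightarrow{\varphi}y'$, $x\xrightarrow{T}x'$. It is a factor if it is a surjective function and (iii) whenever $x\xrightarrow{\varphi}y$ and $x\xrightarrow{T}x'$ there is $y'$ with $y\xrightarrow{S}y'$ and $x'\xrightarrow{\varphi}y'$.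 It is an embedding if it is total and partition-injective and (iv) whenever $x\xrightarrow{\varphi}y$ and $y\xrightarrow{S}y'$ there is $x'$ with $x\xrightarrow{T}x'$ and $x'\xrightarrow{\varphi}y'$. An embedding-factor pair (ef-pair) $(e,f):(X,T)\to(Y,S)$ consists of an embedding $e:(X,T)\to(Y,S)$ and a factor $f:(Y,S)\to(X,T)$ with $f\circ e(x)=\{x\}$ for all $x\in X$ and $y\in e\circ f(y)$ for all $y\in Y$. Composition: $(e',f')\circ(e,f)=(e'\circ e,f\circ f')$. Order theory. An algebraic lattice is a lattice (every finite subset has a least upper bound and a greatest lower bound) in which every directed subset has a least upper bound and in which, for every $x$, the set of compact elements $c\leq x$ is directed with least upper bound $x$; here $c$ is compact if whenever $D$ is directed with $\bigvee D\geq c$, some $d\in D$ has $d\geq c$. A function is Scott continuous if it preserves least upper bounds of directed sets. A co-atom is an element $c$ that is not the greatest element and such that $c\leq y$ implies $y=c$ or $y$ is the greatest element. $\mathrm{CoAt}(x)$ is the set of co-atoms $c\geq x$. A function $g:A\to B$ of algebraic lattices is co-atomic if $g(x)=\bigwedge g[\mathrm{CoAt}(x)]$ for all $x\in A$. $\mathsf{bAlg}^{\mathsf{c}}$ is the category whose objects are the algebraic lattices whose compact elements form a countable sublattice that is a Boolean algebra, and whose morphisms are the Scott-continuous co-atomic functions. Functions are ordered pointwise. Composition in $\mathsf{dynAlg}$ is $(\epsilon',\pi')\circ(\epsilon,\pi)=(\epsilon'\circ\epsilon,\pi\circ\pi')$. $\mathsf{F}$. $\mathsf{F}(X)$ is the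 set of closed subsets of $X$ (including $\emptyset$) ordered by reverse inclusion; for a closed-valued upper-hemicontinuous $g:X\rightrightarrows Y$, $\mathsf{F}(g):\mathsf{F}(X)\to\mathsf{F}(Y)$ maps $A$ to $g[A]$.
   Formalization: As stated it fails: pairs (A, α) with α constantly the top element are not images of nontrivial systems. Proved instead: nontrivial systems are equivalent to the pairs with α not constantly top, and all systems (trivial ones included) are equivalent to dynAlg. *)

(* Defs.v *)
From HB Require Import structures.
From mathcomp Require Import all_boot all_order.
From mathcomp Require Import boolp classical_sets functions cardinality filter.
From mathcomp Require Import topology.

Set Implicit Arguments.
Unset Strict Implicit.
Unset Printing Implicit Defensive.

Import Order.TTheory.

Local Obligation Tactic := idtac.

Local Open Scope order_scope.
Local Open Scope classical_set_scope.

Record category := Category {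
  ob :> Type;
  hom : ob -> ob -> Type;
  idc : forall a, hom a a;
  compc : forall a b c, hom b c -> hom a b -> hom a c;
  comp_idl : forall a b (f : hom a b), compc (idc b) f = f;
  comp_idr : forall a b (f : hom a b), compc f (idc a) = f;
  comp_assoc : forall a b c d (h : hom c d) (g : hom b c) (f : hom a b),
    compc h (compc g f) = compc (compc h g) f }.

Arguments hom {_} _ _.
Arguments idc {_} a.
Arguments compc {_ _ _ _} g f : rename.

Notation "g \oc f" := (compc g f) (at level 50, left associativity).

Definition is_iso (C : category) (a b : C) (f : hom a b) :=
  exists g : hom b a, g \oc f = idc a /\ f \oc g = idc b.

Record functor (C D : category) := Functor {
  fob :> C -> D;
  fmor : forall a b : C, hom a b -> hom (fob a) (fob b);
  fmor_id : forall a : C, fmor (idc a) = idc (fob a);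
  fmor_comp : forall (a b c : C) (g : hom b c) (f : hom a b),
    fmor (g \oc f) = fmor g \oc fmor f }.

Definition functor_id (C : category) : functor C C :=
  @Functor C C id (fun _ _ => id) (fun _ => erefl) (fun _ _ _ _ _ => erefl).

Program Definition functor_comp (C D E : category) (G : functor D E)
    (F : functor C D) : functor C E :=
  @Functor C E (fun a => G (F a)) (fun a b f => fmor G (fmor F f)) _ _.
Next Obligation. by move=> C D E G F a /=; rewrite !fmor_id. Qed.
Next Obligation. by move=> C D E G F a b c g f /=; rewrite !fmor_comp. Qed.

Definition nat_isomorphic (C D : category) (F G : functor C D) :=
  exists eta : forall a : C, hom (F a) (G a),
    (forall a, is_iso (eta a)) /\
    (forall (a b : C) (f : hom a b), fmor G f \oc eta a = eta b \oc fmor F f).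

Definition is_equivalence (C D : category) (F : functor C D) :=
  exists G : functor D C,
    nat_isomorphic (functor_comp G F) (functor_id C) /\
    nat_isomorphic (functor_comp F G) (functor_id D).

Program Definition full_subcategory (C : category) (P : C -> Prop) : category :=
  @Category {a : C | P a} (fun a b => hom (sval a) (sval b))
    (fun a => idc (sval a)) (fun _ _ _ g f => g \oc f) _ _ _.
Next Obligation. by move=> *; exact: comp_idl. Qed.
Next Obligation. by move=> *; exact: comp_idr. Qed.
Next Obligation. by move=> *; exact: comp_assoc. Qed.

Program Definition functor_restrict (C D : category) (F : functor C D)
    (P : C -> Prop) (Q : D -> Prop) (PQ : forall a, P a -> Q (F a)) :
    functor (full_subcategory P) (full_subcategory Q) :=
  @Functor (full_subcategory P) (full_subcategory Q)
    (fun a => exist _ (F (sval a)) (PQ _ (svalP a))) (fun a b f => fmor F f) _ _.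
Next Obligation. by move=> C D F P Q PQ a; exact: fmor_id. Qed.
Next Obligation. by move=> C D F P Q PQ a b c g f; exact: fmor_comp. Qed.

Definition mf_image (X Y : Type) (F : X -> set Y) (A : set X) : set Y :=
  \bigcup_(x in A) F x.

Definition mf_comp (X Y Z : Type) (G : Y -> set Z) (F : X -> set Y) : X -> set Z :=
  fun x => mf_image G (F x).

Definition mf_id (X : Type) : X -> set X := fun x => [set x].

Definition mf_total (X Y : Type) (F : X -> set Y) := forall x, F x !=set0.

Definition partition_injective (X Y : Type) (F : X -> set Y) :=
  (forall x x', x <> x' -> F x `&` F x' = set0) /\ (forall y, exists x, F x y).

Definition surjective_function (X Y : Type) (F : X -> set Y) :=
  exists f : X -> Y, (forall x, F x = [set f x]) /\ (forall y, exists x, f x = y).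

Definition closed_valued (X Y : topologicalType) (F : X -> set Y) :=
  forall x, closed (F x).

Definition upper_hemicontinuous (X Y : topologicalType) (F : X -> set Y) :=
  forall x (V : set Y), open V -> F x `<=` V ->
    exists2 U : set X, open U /\ U x & forall x', U x' -> F x' `<=` V.

Definition cv_uhc (X Y : topologicalType) (F : X -> set Y) :=
  closed_valued F /\ upper_hemicontinuous F.

(* [zero_dimensional] of the library only says that clopen sets separate points. *)
Definition clopen_basis (X : topologicalType) :=
  exists2 B : set (set X), B `<=` clopen & basis B.

Record stone_space (X : topologicalType) : Prop := StoneSpace {
  stone_clopen : clopen_basis X;
  stone_second : @second_countable X;
  stone_compact : compact [set: X];
  stone_hausdorff : hausdorff_space X }.

Record system := System {
  space :> topologicalType;
  spaceP : stone_space space;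
  dyn : space -> set space;
  dynP : cv_uhc dyn }.

Definition nontrivial_system (X : system) := exists x x' : X, dyn x x'.

Record system_morphism (X Y : system) (phi : X -> set Y) : Prop := SystemMorphism {
  sm_cv_uhc : cv_uhc phi;
  sm_forth : forall x x' : X, dyn x x' ->
    exists y y' : Y, [/\ phi x y, phi x' y' & dyn y y'];
  sm_back : forall y y' : Y, dyn y y' ->
    exists x x' : X, [/\ phi x y, phi x' y' & dyn x x'] }.

Record is_factor (X Y : system) (phi : X -> set Y) : Prop := IsFactor {
  factor_morphism : system_morphism phi;
  factor_surj : surjective_function phi;
  factor_lift : forall (x x' : X) (y : Y), phi x y -> dyn x x' ->
    exists2 y' : Y, dyn y y' & phi x' y' }.

Record is_embedding (X Y : system) (phi : X -> set Y) : Prop := IsEmbedding {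
  embedding_morphism : system_morphism phi;
  embedding_total : mf_total phi;
  embedding_inj : partition_injective phi;
  embedding_lift : forall (x : X) (y y' : Y), phi x y -> dyn y y' ->
    exists2 x' : X, dyn x x' & phi x' y' }.

Record is_ef_pair (X Y : system) (e : X -> set Y) (f : Y -> set X) : Prop := IsEFPair {
  ef_embedding : is_embedding e;
  ef_factor : is_factor f;
  ef_section : forall x, mf_comp f e x = [set x];
  ef_retract : forall y, mf_comp e f y y }.

Record ef_pair (X Y : system) := EFPair {
  emb : X -> set Y;
  fac : Y -> set X;
  ef_pairP : is_ef_pair emb fac }.

Section OrderTheory.
Local Open Scope order_scope.
Context {d : Order.disp_t} {L : tbLatticeType d}.
Implicit Types (D K : set L) (x y c k : L).

(* Directed sets are nonempty; otherwise Scott-continuous maps would have to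
   preserve the bottom element, and [F(T)] would only be one for surjective [T]. *)
Definition directed D :=
  D !=set0 /\ forall x y, D x -> D y -> exists2 z, D z & x <= z /\ y <= z.

Definition compact_element c :=
  forall D s, directed D -> supremums D s -> c <= s -> exists2 a, D a & c <= a.

Definition algebraic_lattice :=
  (forall D, directed D -> supremums D !=set0) /\
  (forall x, let D := [set c | compact_element c /\ c <= x] in
     directed D /\ supremums D x).

(* The bounds [zero] and [one] are those of [K]; for the compact elements of an
   algebraic lattice they turn out to be [\bot] and [\top]. *)
Definition boolean_sublattice K :=
  [/\ forall x y, K x -> K y -> K (x `&` y) /\ K (x `|` y),
      forall x y z, K x -> K y -> K z -> x `&` (y `|` z) = (x `&` y) `|` (x `&` z) &
      exists zero one, [/\ K zero /\ K one, forall x, K x -> zero <= x <= one &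
        forall x, K x -> exists2 y, K y & x `&` y = zero /\ x `|` y = one]].

Definition coatom c := c <> \top /\ forall y, c <= y -> y = c \/ y = \top.

Definition CoAt x : set L := [set c | coatom c /\ x <= c].

End OrderTheory.

Arguments algebraic_lattice {d} L.

Definition scott_continuous d d' (A : tbLatticeType d) (B : tbLatticeType d')
    (g : A -> B) :=
  forall (D : set A) s, directed D -> supremums D s -> supremums (g @` D) (g s).

Definition coatomic d d' (A : tbLatticeType d) (B : tbLatticeType d') (g : A -> B) :=
  forall x, infimums (g @` CoAt x) (g x).

Record balg := BAlg {
  balg_disp : Order.disp_t;
  balg_lattice :> tbLatticeType balg_disp;
  balg_algebraic : algebraic_lattice balg_lattice;
  balg_countable : countable [set c : balg_lattice | compact_element c];
  balg_boolean : boolean_sublattice [set c : balg_lattice | compact_element c] }.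

Record balg_hom (A B : balg) := BAlgHom {
  balg_fun :> A -> B;
  balg_scott : scott_continuous balg_fun;
  balg_coatomic : coatomic balg_fun }.

Lemma balg_hom_eq (A B : balg) (f g : balg_hom A B) :
  (forall x, f x = g x) -> f = g.
Proof.
case: f => f f1 f2; case: g => g g1 g2 /= /funext fg; subst g.
by congr BAlgHom; exact: Prop_irrelevance.
Qed.

Section BAlgTheory.
Local Open Scope order_scope.
Variable A : balg.
Implicit Types (x y k n b c : A).

Let alg := balg_algebraic A.
Local Notation K := (@compact_element _ A).

Lemma compact_le x y : (forall k, K k -> k <= x -> k <= y) -> x <= y.
Proof.
move=> h; have [_ [_]] := alg.2 x; apply => k [Kk kx]; exact: h.
Qed.

Lemma compact_bot : K \bot.
Proof. by move=> D s [[a Da] _] _ _; exists a => //; exact: le0x. Qed.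

Lemma compact_join k n : K k -> K n -> K (k `|` n).
Proof. by have [/(_ k n) + _ _] := balg_boolean A; move=> /[apply]/[apply]-[]. Qed.

Lemma compact_meet k n : K k -> K n -> K (k `&` n).
Proof. by have [/(_ k n) + _ _] := balg_boolean A; move=> /[apply]/[apply]-[]. Qed.

Lemma compact_top_compl :
  K \top /\ forall k, K k -> exists2 n, K n & k `&` n = \bot /\ k `|` n = \top.
Proof.
have [_ _ [o [u [[Ko Ku] ou compl]]]] := balg_boolean A.
have u1 : u = \top.
  apply/eqP; rewrite -le1x.
  by apply: compact_le => k Kk _; have /andP[] := ou _ Kk.
have o0 : o = \bot.
  by apply/eqP; rewrite -lex0; have /andP[] := ou _ compact_bot.
by subst; split.
Qed.

Lemma compact_distr x y z : K x -> K y -> K z ->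
  x `&` (y `|` z) = (x `&` y) `|` (x `&` z).
Proof. by have [_ h _] := balg_boolean A; exact: h. Qed.

Lemma compact_distr2 x y z : K x -> K y -> K z ->
  x `|` (y `&` z) = (x `|` y) `&` (x `|` z).
Proof.
move=> Kx Ky Kz; rewrite compact_distr //; last exact: compact_join.
rewrite [_ `&` x]meetC meetC joinKI // [(x `|` y) `&` z]meetC compact_distr //.
by rewrite joinA [z `&` x]meetC meetKU [z `&` y]meetC.
Qed.

Lemma compact_le_join k n x : K k -> k <= x `|` n ->
  exists2 m, K m /\ m <= x & k <= m `|` n.
Proof.
move=> Kk kxn.
have [[D0 Ddir] [Dub Dlub]] := alg.2 x.
pose E := [set m `|` n | m in [set c | K c /\ c <= x]].
have Edir : directed E.
  split; first by have [m mD] := D0; exists (m `|` n); exists m.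
  move=> _ _ [m1 m1D <-] [m2 m2D <-].
  have [m mD [m1m m2m]] := Ddir _ _ m1D m2D.
  by exists (m `|` n); [exists m|split; exact: leU2].
have Esup : supremums E (x `|` n).
  split; first by move=> _ [m [_ mx] <-]; exact: leU2.
  move=> z zE; rewrite leUx; apply/andP; split.
    apply: Dlub => m mD; apply: le_trans (zE (m `|` n) _); last by exists m.
    exact: leUl.
  have [m mD] := D0; apply: le_trans (zE (m `|` n) _); last by exists m.
  exact: leUr.
by have [_ [m mD <-] kmn] := Kk _ _ Edir Esup kxn; exists m.
Qed.

Lemma compact_le_compl k n x : K k -> K n -> k `&` n = \bot ->
  x `|` n = \top -> k <= x.
Proof.
move=> Kk Kn kn0 xn1.
have [m [Km mx] +] : exists2 m, K m /\ m <= x & k <= m `|` n.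
  by apply: compact_le_join => //; rewrite xn1 lex1.
rewrite leEmeet compact_distr // kn0 joinx0 -leEmeet => km.
exact: le_trans mx.
Qed.

Lemma coatom_above x : x <> \top -> exists c, CoAt x c.
Proof.
move=> x1; pose T := {y : A | x <= y /\ y <> \top}.
pose R (s t : T) := sval s <= sval t.
have [||||[c [xc c1]] cmax] := @Zorn T R.
- by move=> t; exact: lexx.
- by move=> r s t; exact: le_trans.
- move=> [s sP] [t tP] st ts; apply: eq_exist.
  by apply/eqP; rewrite eq_le; apply/andP.
- move=> C Ctot; have [[t0 Ct0]|C0] := pselect (C !=set0); last first.
    by exists (exist _ x (conj (lexx x) x1)) => s Cs; case: C0; exists s.
  pose D := [set sval t | t in C].
  have Ddir : directed D.
    split; first by exists (sval t0); exists t0.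
    move=> _ _ [s Cs <-] [t Ct <-].
    by have [st|ts] := Ctot _ _ Cs Ct;
      [exists (sval t); [exists t|split]|exists (sval s); [exists s|split]].
  have [s [sub slub]] := alg.1 _ Ddir.
  have xs : x <= s.
    by apply: le_trans (svalP t0).1 _; apply: sub; exists t0.
  have s1 : s <> \top.
    move=> s1; have [K1 _] := compact_top_compl.
    have [_ [t Ct <-]] := K1 _ _ Ddir (conj sub slub) (eq_ind_r (fun z => \top <= z) (lexx _) s1).
    by rewrite le1x => /eqP; exact: (svalP t).2.
  by exists (exist _ s (conj xs s1)) => t Ct; apply: sub; exists t.
- exists c; split=> //; split=> // y cy.
  have [->|y1] := pselect (y = \top); [by right|left].
  by have := cmax (exist _ y (conj (le_trans xc cy) y1)) cy; case.
Qed.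

Lemma coatom_prime b x y : coatom b -> x `&` y <= b -> x <= b \/ y <= b.
Proof.
move=> [b1 bmax] xyb; apply: contrapT => /not_orP[xb yb].
have [Ktop _] := compact_top_compl.
have key z : ~ z <= b -> exists k m, [/\ K k, k <= z, K m, m <= b & m `|` k = \top].
  move=> zb; have [k [Kk kz kb]] : exists k, [/\ K k, k <= z & ~ k <= b].
    apply: contrapT => h; apply: zb; apply: compact_le => k Kk kz.
    by apply: contrapT => kb; apply: h; exists k.
  have bk1 : b `|` k = \top.
    have [bk|//] := bmax (b `|` k) (leUl _ _).
    by case: kb; rewrite -bk leUr.
  have [m [Km mb]] : exists2 m, K m /\ m <= b & \top <= m `|` k.
    by apply: compact_le_join => //; rewrite bk1.
  by rewrite le1x => /eqP mk; exists k, m.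
have [k1 [m1 [Kk1 k1x Km1 m1b e1]]] := key _ xb.
have [k2 [m2 [Kk2 k2y Km2 m2b e2]]] := key _ yb.
apply: b1; apply/eqP; rewrite -le1x.
have e : (m1 `|` m2) `|` (k1 `&` k2) = \top.
  rewrite compact_distr2 //; last exact: compact_join.
  by rewrite joinAC e1 join1x meet1x -joinA e2 joinx1.
rewrite -e !leUx m1b m2b /=; apply: le_trans xyb.
exact: leI2.
Qed.

Lemma coatom_inf x : infimums (CoAt x) x.
Proof.
split; first by move=> c [].
move=> z zlb; apply: compact_le => k Kk kz.
have [_ /(_ k Kk)[n Kn [kn0 kn1]]] := compact_top_compl.
apply: (compact_le_compl Kk Kn kn0); apply: contrapT => /coatom_above[c [cc]].
rewrite leUx => /andP[xc nc]; apply: cc.1; apply/eqP; rewrite -le1x -kn1 leUx nc.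
by rewrite andbT (le_trans kz) // zlb.
Qed.

End BAlgTheory.

Lemma scott_mono d d' (A : tbLatticeType d) (B : tbLatticeType d') (g : A -> B) :
  scott_continuous g -> forall x y, x <= y -> g x <= g y.
Proof.
move=> gs x y xy; pose D := [set z | z = x \/ z = y].
have Dy z : D z -> z <= y by case=> ->.
have Ddir : directed D.
  split; first by exists x; left.
  by move=> a b Da Db; exists y; [right|split; exact: Dy].
have Dsup : supremums D y by split=> [z|z h]; [exact: Dy|apply: h; right].
by have [gub _] := gs D y Ddir Dsup; apply: gub; exists x => //; left.
Qed.

Section BAlgComp.
Local Open Scope order_scope.
Variables (A B C : balg) (g : balg_hom B C) (f : balg_hom A B).

Let fmono := scott_mono (balg_scott f).
Let gmono := scott_mono (balg_scott g).

(* The co-atoms above [f x] are those above the [f c], [c] a co-atom above [x]. *)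
Lemma CoAt_image x b : CoAt (f x) b -> exists2 c, CoAt x c & CoAt (f c) b.
Proof.
move=> [bc fxb]; apply: contrapT => noc.
pose P := [set k | compact_element k /\ ~ f k <= b].
have [Ktop compl] := compact_top_compl A.
have above c : CoAt x c -> exists2 k, P k & k <= c.
  move=> xc; apply: contrapT => nok; apply: noc; exists c => //; split=> //.
  have [Ddir Dsup] := (balg_algebraic A).2 c.
  have [_ lub] := balg_scott f Ddir Dsup; apply: lub => _ [k [Kk kc] <-].
  by apply: contrapT => fkb; apply: nok; exists k.
suff [k [_ fkb] kx] : exists2 k, P k & k <= x.
  by apply: fkb; apply: le_trans fxb; exact: fmono.
have Pmeet k1 k2 : P k1 -> P k2 -> P (k1 `&` k2).
  move=> [Kk1 fk1] [Kk2 fk2]; split; first exact: compact_meet.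
  move=> h; have fk12 : f k1 `&` f k2 <= b.
    apply: le_trans h; have [_ glb] := balg_coatomic f (k1 `&` k2).
    apply: glb => _ [c [cc kc] <-].
    by have [/fmono|/fmono] := coatom_prime cc kc; apply: le_trans;
      [exact: leIl|exact: leIr].
  by have [] := coatom_prime bc fk12.
pose E := [set n | compact_element n /\
  exists2 k, P k & k `&` n = \bot /\ k `|` n = \top].
pose D := [set x `|` n | n in E].
have PT : P \top.
  split=> //; have [_ glb] := balg_coatomic f \top.
  move=> fTb; apply: bc.1; apply/eqP; rewrite -le1x; apply: le_trans fTb.
  by apply: glb => _ [c [[c1 _] c1'] <-]; case: c1; apply/eqP; rewrite -le1x.
have Ddir : directed D.
  split.
    exists (x `|` \bot), \bot => //; split; first exact: compact_bot.
    by exists \top => //; rewrite meetx0 joinx0.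
  move=> _ _ [n1 [Kn1 [k1 Pk1 [kn1 kn1']]] <-] [n2 [Kn2 [k2 Pk2 [kn2 kn2']]] <-].
  have [Kk1 _] := Pk1; have [Kk2 _] := Pk2.
  exists (x `|` (n1 `|` n2)); last by split; apply: leU2 => //; [exact: leUl|exact: leUr].
  exists (n1 `|` n2) => //; split; first exact: compact_join.
  exists (k1 `&` k2); first exact: Pmeet.
  split.
    rewrite compact_distr //; last exact: compact_meet.
    by rewrite meetAC kn1 meet0x -meetA kn2 meetx0 joinx0.
  rewrite joinC compact_distr2 //; last exact: compact_join.
  by rewrite joinAC [n1 `|` k1]joinC kn1' join1x meet1x -joinA [n2 `|` k2]joinC kn2' joinx1.
have [s [sub slub]] := (balg_algebraic A).1 _ Ddir.
have [s1|/coatom_above[c [cc sc]]] := pselect (s = \top).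
  have [_ [n [Kn [k Pk [kn0 _]]] <-]] :=
    Ktop _ _ Ddir (conj sub slub) (eq_ind_r (fun z => \top <= z) (lexx _) s1).
  rewrite le1x => /eqP xn1; exists k => //.
  exact: compact_le_compl Pk.1 Kn kn0 xn1.
have xc : x <= c.
  apply: le_trans sc; apply: le_trans (sub (x `|` \bot) _); first exact: leUl.
  exists \bot => //; split; first exact: compact_bot.
  by exists \top => //; rewrite meetx0 joinx0.
have [k Pk kc] := above _ (conj cc xc); have [n Kn [kn0 kn1]] := compl _ Pk.1.
case: cc.1; apply/eqP; rewrite -le1x -kn1 leUx kc /=; apply: le_trans sc.
by apply: le_trans (sub (x `|` n) _); [exact: leUr|exists n => //; split=> //; exists k].
Qed.

Lemma scott_comp : scott_continuous (g \o f).
Proof.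
move=> D s Ddir Dsup; rewrite -image_comp; apply: balg_scott.
  have [[a Da] Dd] := Ddir; split; first by exists (f a), a.
  move=> _ _ [x Dx <-] [y Dy <-]; have [z Dz [xz yz]] := Dd _ _ Dx Dy.
  by exists (f z); [exists z|split; exact: fmono].
exact: balg_scott.
Qed.

Lemma coatomic_comp : coatomic (g \o f).
Proof.
move=> x; split; first by move=> _ [c [_ xc] <-] /=; apply/gmono/fmono.
move=> z zlb /=; have [_ glb] := balg_coatomic g (f x).
apply: glb => _ [b /CoAt_image[c xc [bc fcb]] <-].
apply: le_trans (gmono fcb); apply: zlb; by exists c.
Qed.

Definition balg_comp := BAlgHom scott_comp coatomic_comp.

End BAlgComp.

Lemma scott_id (A : balg) : @scott_continuous _ _ A A id.
Proof. by move=> D s; rewrite image_id. Qed.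

Lemma coatomic_id (A : balg) : @coatomic _ _ A A id.
Proof. by move=> x; rewrite image_id; exact: coatom_inf. Qed.

Definition balg_id (A : balg) := BAlgHom (@scott_id A) (@coatomic_id A).

Program Definition bAlgc : category :=
  @Category balg balg_hom balg_id balg_comp _ _ _.
Next Obligation. by move=> A B f; exact: balg_hom_eq. Qed.
Next Obligation. by move=> A B f; exact: balg_hom_eq. Qed.
Next Obligation. by move=> A B C D h g f; exact: balg_hom_eq. Qed.

Definition balg_le (A B : balg) (f g : balg_hom A B) := forall x, f x <= g x.

Record dyn_lattice := DynLattice {
  dl_alg :> bAlgc;
  dl_map : hom dl_alg dl_alg }.

Record is_dyn_pair (A B : dyn_lattice) (eps : @hom bAlgc A B) (pi : @hom bAlgc B A) :
    Prop := IsDynPair {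
  dp_coatom : forall b : dl_alg B, coatom b -> coatom (pi b);
  dp_section : pi \oc eps = idc (dl_alg A);
  dp_retract : balg_le (eps \oc pi) (idc (dl_alg B));
  dp_lower : balg_le (pi \oc dl_map B \oc eps) (dl_map A);
  dp_upper : balg_le (dl_map A \oc pi) (pi \oc dl_map B) }.

Record dyn_pair (A B : dyn_lattice) := DynPair {
  dp_eps : @hom bAlgc A B;
  dp_pi : @hom bAlgc B A;
  dyn_pairP : is_dyn_pair dp_eps dp_pi }.

Lemma dyn_pair_eq (A B : dyn_lattice) (p q : dyn_pair A B) :
  dp_eps p = dp_eps q -> dp_pi p = dp_pi q -> p = q.
Proof.
case: p => e f efP; case: q => e' f' efP' /= ee ff; subst e' f'.
by congr DynPair; exact: Prop_irrelevance.
Qed.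

Program Definition dyn_id (A : dyn_lattice) : dyn_pair A A :=
  @DynPair A A (idc (dl_alg A)) (idc (dl_alg A)) _.
Next Obligation.
by move=> A; split=> //; [exact: comp_idl|..]; move=> x; exact: lexx.
Qed.

Program Definition dyn_comp (A B C : dyn_lattice) (q : dyn_pair B C)
    (p : dyn_pair A B) : dyn_pair A C :=
  @DynPair A C (dp_eps q \oc dp_eps p) (dp_pi p \oc dp_pi q) _.
Next Obligation.
move=> A B C [e' f' [h1' h2' h3' h4' h5']] [e f [h1 h2 h3 h4 h5]] /=.
have fm := scott_mono (balg_scott f); have em' := scott_mono (balg_scott e').
split.
- by move=> b /h1'/h1.
- by rewrite comp_assoc -[X in X \oc e]comp_assoc h2' comp_idr.
- by move=> x; apply: le_trans (h3' x); apply/em'/h3.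
- by move=> x; apply: le_trans (h4 x); apply/fm/h4'.
- by move=> x; apply: le_trans (h5 _) _; apply/fm/h5'.
Qed.

Program Definition dynAlg : category :=
  @Category dyn_lattice dyn_pair dyn_id dyn_comp _ _ _.
Next Obligation. by move=> A B f; apply: dyn_pair_eq; [exact: comp_idl|exact: comp_idr]. Qed.
Next Obligation. by move=> A B f; apply: dyn_pair_eq; [exact: comp_idr|exact: comp_idl]. Qed.
Next Obligation.
by move=> A B C D h g f; apply: dyn_pair_eq; [|symmetry]; exact: comp_assoc.
Qed.

Lemma clopen_separation (X : topologicalType) : stone_space X ->
  forall (A : set X) x, closed A -> ~ A x ->
  exists V : set X, [/\ clopen V, V x & V `&` A = set0].
Proof.
move=> [[B Bclopen [_ Bx]] _ _ _] A x cA nAx.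
have [V [BV Vx] VA] : filter_from [set U | B U /\ U x] id (~` A).
  apply: Bx; apply: open_nbhs_nbhs; split=> //; exact: closed_openC.
exists V; split=> //; first exact: Bclopen.
by rewrite -subset0 => y [/VA].
Qed.

Lemma directed_inter (X : topologicalType) (D : set (set X)) (C : set X) :
  compact [set: X] -> closed C -> D !=set0 -> (forall A, D A -> closed A) ->
  (forall A B, D A -> D B -> exists2 E, D E & E `<=` A `&` B) ->
  (forall A, D A -> A `&` C !=set0) -> exists2 x, C x & forall A, D A -> A x.
Proof.
move=> cX cC [A0 DA0] Dcl Ddir Dne.
pose F := filter_from D (fun A => A `&` C).
have FF : ProperFilter F.
  apply: filter_from_proper => //; apply: filter_from_filter; first by exists A0.
  move=> A B DA DB; have [E DE EAB] := Ddir _ _ DA DB; exists E => //.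
  by move=> x [/EAB[]].
have [x [_ Fx]] := cX F FF filterT.
exists x => [|A DA].
  by apply: cC => U xU; apply: Fx => //; exists A0 => // y [].
by apply: (Dcl _ DA) => U xU; apply: Fx => //; exists A => // y [].
Qed.

Section ClosedRelations.
Variables (X Y : topologicalType) (sX : stone_space X) (sY : stone_space Y).

Lemma closed_set1 (x : X) : closed [set x].
Proof.
apply: compact_closed; [exact: stone_hausdorff|exact: compact_set1].
Qed.

Variables (g : X -> set Y) (gP : cv_uhc g).

Lemma cv_uhc_separation x y : ~ g x y -> exists U V,
  [/\ open U /\ U x, clopen V /\ V y & forall x', U x' -> g x' `&` V = set0].
Proof.
move=> gxy; have [V [Vcl Vy Vg]] := clopen_separation sY (gP.1 x) gxy.
have [||U [oU Ux] UV] := gP.2 x (~` V).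
- by apply: closed_openC; exact: Vcl.2.
- by move=> z gz Vz; have : (V `&` g x) z by []; rewrite Vg.
exists U, V; split=> // x' /UV gV; rewrite -subset0 => z [/gV].
exact.
Qed.

Lemma closed_fiber y : closed [set x | g x y].
Proof.
move=> x xcl; apply: contrapT => /cv_uhc_separation[U [V [[oU Ux] [_ Vy] UV]]].
have [x' [gx'y Ux']] := xcl U (open_nbhs_nbhs (conj oU Ux)).
by have : (g x' `&` V) y by []; rewrite UV.
Qed.

Lemma closed_image (A : set X) : closed A -> closed (mf_image g A).
Proof.
move=> cA y ycl.
pose D := [set closure [set x | A x /\ g x `&` V !=set0] | V in nbhs y].
have [||||x Ax Dx] := @directed_inter X D A (stone_compact sX) cA.
- by exists (closure [set x | A x /\ g x `&` setT !=set0]), setT => //; exact: filterT.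
- by move=> _ [V _ <-]; exact: closed_closure.
- move=> _ _ [V yV <-] [W yW <-].
  exists (closure [set x | A x /\ g x `&` (V `&` W) !=set0]).
    by exists (V `&` W) => //; exact: filterI.
  rewrite subsetI; split; apply: closureS => x [Ax [z [gz [Vz Wz]]]];
    by split=> //; exists z.
- move=> _ [V yV <-]; have [z [[x Ax gxz] Vz]] := ycl _ yV.
  by exists x; split=> //; apply: subset_closure; split=> //; exists z.
exists x => //; apply: contrapT => /cv_uhc_separation[U [V [[oU Ux] [Vcl Vy] UV]]].
have yV : nbhs y V by apply: open_nbhs_nbhs; split=> //; exact: Vcl.1.
have /(_ U (open_nbhs_nbhs (conj oU Ux)))[x' [[_ [z gVz]] Ux']] := Dx _ (ex_intro2 _ _ V yV erefl).
by rewrite UV in gVz.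
Qed.

End ClosedRelations.

Lemma cv_uhc_comp (X Y Z : topologicalType) (sY : stone_space Y)
    (sZ : stone_space Z) (g : Y -> set Z) (f : X -> set Y) :
  cv_uhc g -> cv_uhc f -> cv_uhc (mf_comp g f).
Proof.
move=> gP fP; split=> [x|x V oV gfV]; first by apply: closed_image => //; exact: fP.1.
pose W := \bigcup_(U in [set U | open U /\ forall y, U y -> g y `<=` V]) U.
have [||U Ux UW] := fP.2 x W.
- by apply: bigcup_open => U [].
- move=> y fy; have [U [oU Uy] UV] := gP.2 y V oV (fun z gz => gfV z (ex_intro2 _ _ y fy gz)).
  by exists U.
exists U => // x' /UW fW z [y /fW[U' [_ U'V] U'y] gz]; exact: U'V gz.
Qed.

Lemma cv_uhc_id (X : topologicalType) : stone_space X -> cv_uhc (@mf_id X).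
Proof.
move=> sX; split=> [x|x V oV xV]; first exact: closed_set1.
by exists V => [|x' Vx' _ ->//]; split=> //; exact: xV.
Qed.

Lemma ef_pair_eq (X Y : system) (p q : ef_pair X Y) :
  emb p = emb q -> fac p = fac q -> p = q.
Proof.
case: p => e f efP; case: q => e' f' efP' /= ee ff; subst e' f'.
by congr EFPair; exact: Prop_irrelevance.
Qed.

Lemma mf_comp_id_l (X Y : Type) (F : X -> set Y) : mf_comp (@mf_id Y) F = F.
Proof.
apply/funext => x; apply/seteqP; split=> [y [y' Fy' ->]//|y Fy]; by exists y.
Qed.

Lemma mf_comp_id_r (X Y : Type) (F : X -> set Y) : mf_comp F (@mf_id X) = F.
Proof. by apply/funext => x; rewrite /mf_comp /mf_image bigcup_set1. Qed.

Lemma mf_compA (X Y Z W : Type) (H : Z -> set W) (G : Y -> set Z) (F : X -> set Y) :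
  mf_comp H (mf_comp G F) = mf_comp (mf_comp H G) F.
Proof.
apply/funext => x; apply/seteqP; split=> w.
  by move=> [z [y Fy Gz] Hw]; exists y => //; exists z.
by move=> [y Fy [z Gz Hw]]; exists z => //; exists y.
Qed.

Lemma system_morphism_comp (X Y Z : system) (g : Y -> set Z) (f : X -> set Y) :
  system_morphism g -> system_morphism f -> system_morphism (mf_comp g f).
Proof.
move=> [g1 g2 g3] [f1 f2 f3]; split.
- by apply: cv_uhc_comp => //; exact: spaceP.
- move=> x x' /f2[y [y' [xy xy' /g2[z [z' [yz yz' zz']]]]]].
  by exists z, z'; split=> //; [exists y|exists y'].
- move=> z z' /g3[y [y' [yz yz' /f3[x [x' [xy xy' xx']]]]]].
  by exists x, x'; split=> //; [exists y|exists y'].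
Qed.

Program Definition ef_id (X : system) : ef_pair X X :=
  @EFPair X X (@mf_id X) (@mf_id X) _.
Next Obligation.
move=> X; have idP : @system_morphism X X (@mf_id X).
  split; first exact/cv_uhc_id/spaceP.
    by move=> x x' xx'; exists x, x'.
  by move=> x x' xx'; exists x, x'.
split; last by move=> y; rewrite mf_comp_id_l.
- split=> //; first by move=> x; exists x.
    split=> [x x' xx'|y]; last by exists y.
    by rewrite -subset0 => y [->] /xx'.
  by move=> x y y' -> yy'; exists y'.
- split=> //; first by exists id; split=> // y; exists y.
  by move=> x x' y -> xx'; exists x'.
- by move=> x; rewrite mf_comp_id_l.
Qed.

Program Definition ef_comp (X Y Z : system) (q : ef_pair Y Z) (p : ef_pair X Y) :
    ef_pair X Z :=
  @EFPair X Z (mf_comp (emb q) (emb p)) (mf_comp (fac p) (fac q)) _.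
Next Obligation.
move=> X Y Z [e' f' [E' F' s' r']] [e f [E F s r]] /=; split.
- case: E' => m' t' [i' o'] l'; case: E => m t [i o] l; split.
  + exact: system_morphism_comp.
  + by move=> x; have [y ey] := t x; have [z ez] := t' y; exists z, y.
  + split=> [x x' xx'|z].
      rewrite -subset0 => z [[y ey ez] [y' ey' ez']].
      have yy' : y = y'.
        by apply: contrapT => /i'; rewrite -subset0 => /(_ z); exact.
      by have := i _ _ xx'; rewrite -subset0 => /(_ y); apply; split=> //; rewrite yy'.
    by have [y yz] := o' z; have [x xy] := o y; exists x, y.
  + move=> x z z' [y xy yz] zz'; have [y' yy' yz'] := l' _ _ _ yz zz'.
    have [x' xx' xy'] := l _ _ _ xy yy'; by exists x' => //; exists y'.
- case: F' => m' [h' [fh' o']] l'; case: F => m [h [fh o]] l; split.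
  + exact: system_morphism_comp.
  + exists (h \o h'); split=> [z|x].
      by rewrite /mf_comp fh' /mf_image bigcup_set1 fh.
    by have [y <-] := o x; have [z <-] := o' y; exists z.
  + move=> z z' x [y zy yx] zz'; have [y' yy' zy'] := l' _ _ _ zy zz'.
    have [x' xx' yx'] := l _ _ _ yx yy'; by exists x' => //; exists y'.
- move=> x; rewrite -mf_compA [X in mf_comp f X]mf_compA.
  by rewrite (_ : mf_comp f' e' = @mf_id Y) ?mf_comp_id_l //; exact/funext.
- move=> z; rewrite -mf_compA [X in mf_comp e' X]mf_compA.
  by have [y zy yz] := r' z; exists y => //; exists y.
Qed.

Program Definition SysEFall : category :=
  @Category system ef_pair ef_id ef_comp _ _ _.
Next Obligation.
by move=> X Y f; apply: ef_pair_eq; [exact: mf_comp_id_l|exact: mf_comp_id_r].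
Qed.
Next Obligation.
by move=> X Y f; apply: ef_pair_eq; [exact: mf_comp_id_r|exact: mf_comp_id_l].
Qed.
Next Obligation.
by move=> X Y Z W h g f; apply: ef_pair_eq; [|symmetry]; exact: mf_compA.
Qed.

Record closed_set (X : topologicalType) := ClosedSet {
  cset :> set X;
  csetP : closed cset }.

Arguments csetP {X} c.

Lemma closed_set_eq (X : topologicalType) (A B : closed_set X) :
  cset A = cset B -> A = B.
Proof.
case: A => A cA; case: B => B cB /= AB; subst B.
by congr ClosedSet; exact: Prop_irrelevance.
Qed.

(* The order is reverse inclusion: meets are unions, joins are intersections,
   [\bot] is the whole space and [\top] is the empty set. *)
Fact closed_set_display : Order.disp_t. Proof. exact: (Order.Disp tt tt). Qed.

Section ClosedSetLattice.
Variable X : topologicalType.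
Implicit Types A B C : closed_set X.

HB.instance Definition _ := gen_eqMixin (closed_set X).
HB.instance Definition _ := gen_choiceMixin (closed_set X).

Definition cs_le A B : bool := `[< (B : set X) `<=` A >].
Definition cs_meet A B := ClosedSet (closedU (csetP A) (csetP B)).
Definition cs_join A B := ClosedSet (closedI (csetP A) (csetP B)).
Definition cs_bot : closed_set X := ClosedSet (@closedT X).
Definition cs_top : closed_set X := ClosedSet (@closed0 X).

Lemma cs_lexx : reflexive cs_le.
Proof. by move=> A; apply/asboolP. Qed.

Lemma cs_le_anti : antisymmetric cs_le.
Proof.
by move=> A B /andP[/asboolP BA /asboolP AB]; apply/closed_set_eq/seteqP.
Qed.

Lemma cs_le_trans : transitive cs_le.
Proof. by move=> B A C /asboolP BA /asboolP CB; apply/asboolP => x /CB/BA. Qed.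

HB.instance Definition _ :=
  Order.Le_isPOrder.Build closed_set_display (closed_set X)
    cs_lexx cs_le_anti cs_le_trans.

Lemma cs_leP A B : reflect ((B : set X) `<=` A) (A <= B).
Proof. exact: asboolP. Qed.

Lemma cs_meetP A B C : (A <= cs_meet B C) = (A <= B) && (A <= C).
Proof.
apply/cs_leP/andP => [h|[/cs_leP h1 /cs_leP h2] x [/h1|/h2]//].
by split; apply/cs_leP => x ?; apply: h; [left|right].
Qed.

Lemma cs_joinP A B C : (cs_join A B <= C) = (A <= C) && (B <= C).
Proof.
apply/cs_leP/andP => [h|[/cs_leP h1 /cs_leP h2] x Cx]; last by split; [exact: h1|exact: h2].
by split; apply/cs_leP => x /h[].
Qed.

HB.instance Definition _ :=
  Order.POrder_MeetJoin_isLattice.Build closed_set_display (closed_set X)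
    cs_meetP cs_joinP.

Lemma cs_le0x A : cs_bot <= A.
Proof. exact/cs_leP. Qed.

Lemma cs_lex1 A : A <= cs_top.
Proof. exact/cs_leP. Qed.

HB.instance Definition _ :=
  Order.hasBottom.Build closed_set_display (closed_set X) cs_le0x.
HB.instance Definition _ :=
  Order.hasTop.Build closed_set_display (closed_set X) cs_lex1.

End ClosedSetLattice.

Section ClosedSetBAlg.
Variables (X : topologicalType) (sX : stone_space X).
Implicit Types A B : closed_set X.

Let clX := closed_set1 sX.

Definition cs_point (x : X) : closed_set X := ClosedSet (@clX x).

Definition cs_bigcap (D : set (closed_set X)) : closed_set X :=
  @ClosedSet X (\bigcap_(A in D) A) (closed_bigI (fun A _ => csetP A)).

Lemma cs_bigcap_sup (D : set (closed_set X)) : supremums D (cs_bigcap D).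
Proof.
split=> [A DA|B BD]; first by apply/cs_leP => x; exact.
by apply/cs_leP => x Bx A /BD/cs_leP; exact.
Qed.

Lemma cs_supE (D : set (closed_set X)) B : supremums D B -> B = cs_bigcap D.
Proof. by move=> DB; apply: is_subset1_supremums DB _; exact: cs_bigcap_sup. Qed.

Lemma cs_directed_inter (D : set (closed_set X)) (C : set X) : directed D ->
  closed C -> (forall A, D A -> A `&` C !=set0) -> (cs_bigcap D `&` C) !=set0.
Proof.
move=> [[A0 DA0] Ddir] cC Dne.
have [||||x Cx Dx] := @directed_inter X [set (A : set X) | A in D] C (stone_compact sX) cC.
- by exists (A0 : set X), A0.
- by move=> _ [A _ <-]; exact: csetP.
- move=> _ _ [A DA <-] [B DB <-]; have [E DE [/cs_leP AE /cs_leP BE]] := Ddir _ _ DA DB.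
  by exists E; [exists E|move=> x Ex; split; [exact: AE|exact: BE]].
- by move=> _ [A DA <-]; exact: Dne.
- by exists x; split=> // A DA; apply: Dx; exists A.
Qed.

Lemma cs_clopen_compact A : clopen A -> compact_element A.
Proof.
move=> [oA _] D B Ddir /cs_supE -> /cs_leP DA; apply: contrapT => noD.
have [|x [Dx nAx]] := cs_directed_inter Ddir (open_closedC oA).
  move=> B' DB'; apply: contrapT => B'A; apply: noD; exists B' => //.
  by apply/cs_leP => x B'x; apply: contrapT => nAx; apply: B'A; exists x.
exact/nAx/DA.
Qed.

Lemma cs_clopen_directed A :
  let D := [set B : closed_set X | clopen B /\ B <= A] in
  directed D /\ supremums D A.
Proof.
move=> D; split; first split.
- by exists \bot; split; [split; [exact: openT|exact: closedT]|exact: le0x].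
- move=> B C [[oB cB] BA] [[oC cC] CA]; exists (Order.join B C).
    split; last by rewrite leUx BA.
    by split; [exact: openI|exact: closedI].
  by split; [exact: leUl|exact: leUr].
split=> [B []//|B DB]; apply/cs_leP => x Bx; apply: contrapT => nAx.
have [V [[oV cV] Vx VA]] := clopen_separation sX (csetP A) nAx.
have /cs_leP/(_ x Bx) : ClosedSet (open_closedC oV) <= B; last by apply.
apply: DB; split; first by split; [exact: closed_openC|exact: open_closedC].
apply/cs_leP => y Ay Vy; have : (V `&` A) y by [].
by rewrite VA.
Qed.

Lemma cs_compactE : compact_element = [set A : closed_set X | clopen A].
Proof.
apply/seteqP; split=> A; last exact: cs_clopen_compact.
have [Ddir Dsup] := cs_clopen_directed A => /(_ _ _ Ddir Dsup (lexx _)).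
move=> [B [clB BA] AB].
by have -> : A = B by apply/eqP; rewrite eq_le AB.
Qed.

Lemma cs_algebraic : algebraic_lattice (closed_set X).
Proof.
split=> [D _|A]; first by exists (cs_bigcap D); exact: cs_bigcap_sup.
rewrite [X in [set c | X c /\ _]]cs_compactE; exact: cs_clopen_directed.
Qed.

Lemma cs_boolean : boolean_sublattice [set A : closed_set X | compact_element A].
Proof.
rewrite [X in boolean_sublattice X]cs_compactE; split.
- move=> A B [oA cA] [oB cB].
  by split; split; [exact: openU|exact: closedU|exact: openI|exact: closedI].
- move=> A B C _ _ _; apply: closed_set_eq => /=; exact: setUIr.
- exists \bot, \top; split.
  + split; split; [exact: openT|exact: closedT|exact: open0|exact: closed0].
  + by move=> A _; rewrite le0x lex1.
  + move=> A [oA cA]; exists (ClosedSet (open_closedC oA)).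
      by split; [exact: closed_openC|exact: open_closedC].
    by split; apply: closed_set_eq; [exact: setUv|exact: setICr].
Qed.

Lemma cs_countable : countable [set A : closed_set X | compact_element A].
Proof.
rewrite [X in countable X]cs_compactE.
have [B Bcount [Bopen Bbasis]] := stone_second sX.
have /countable_injP[h hinj] := Bcount.
pose F (s : seq nat) : set X := \bigcup_(U in [set U | B U /\ h U \in s]) U.
have clopenF (U : set X) : clopen U -> exists s, U = F s.
  move=> [oU cU]; apply: contrapT => noF.
  pose D := [set A : closed_set X | exists2 s, F s `<=` U & ~` F s = A].
  have Fopen s : open (F s) by apply: bigcup_open => V [/Bopen].
  have [||x [Dx Ux]] := @cs_directed_inter D U _ cU.
  - split.
      exists (ClosedSet (open_closedC (Fopen [::]))), [::] => //.
      by move=> x [V []].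
    move=> A1 A2 [s1 s1U e1] [s2 s2U e2].
    exists (ClosedSet (open_closedC (Fopen (s1 ++ s2)))).
      exists (s1 ++ s2) => // x [V [BV]]; rewrite mem_cat => /orP[] hV Vx.
        by apply: s1U; exists V.
      by apply: s2U; exists V.
    split; apply/cs_leP; rewrite -?e1 -?e2 => x /= nF [V [BV hV] Vx]; apply: nF;
      by exists V => //; split=> //; rewrite mem_cat hV ?orbT.
  - move=> A [s sU eA]; rewrite -eA; apply: contrapT => nU; apply: noF; exists s.
    apply/seteqP; split=> // x Ux; apply: contrapT => nFx; apply: nU; by exists x.
  have [V [BV Vx] VU] : filter_from [set V | B V /\ V x] id U.
    by apply: Bbasis; apply: open_nbhs_nbhs.
  have FV : F [:: h V] `<=` U.
    move=> y [W [BW]]; rewrite inE => /eqP hW Wy; apply: VU.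
    by rewrite -(hinj _ _ _ _ hW) //; exact/mem_set.
  have : (~` F [:: h V]) x.
    by apply: (Dx (ClosedSet (open_closedC (Fopen _)))); exists [:: h V].
  by apply; exists V => //; split=> //; exact: mem_head.
pose s (A : closed_set X) : seq nat := if pselect (clopen A) is left c then sval (cid (clopenF _ c)) else [::].
have sP A : clopen A -> (A : set X) = F (s A).
  by rewrite /s; case: pselect => // c _; case: cid.
apply/countable_injP; exists (pickle \o s) => A A' /set_mem cA /set_mem cA' /=.
by move=> /(pcan_inj pickleK) sAA'; apply: closed_set_eq; rewrite (sP _ cA) (sP _ cA') sAA'.
Qed.

End ClosedSetBAlg.

Lemma cs_coatomP (X : topologicalType) (sX : stone_space X) (A : closed_set X) :
  coatom A <-> exists x, A = cs_point sX x.
Proof.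
split=> [[A1 Amax]|[x ->]].
  have [x Ax] : (A : set X) !=set0.
    apply: contrapT => A0; apply: A1; apply: closed_set_eq => /=.
    by rewrite -subset0 => x Ax; apply: A0; exists x.
  exists x; have [|->//|x1] := Amax (cs_point sX x).
    by apply/cs_leP => _ ->.
  by have : cset (\top : closed_set X) x by rewrite -x1.
split; first by move=> x1; have : cset (\top : closed_set X) x by rewrite -x1.
move=> B /cs_leP Bx; have [[y By]|B0] := pselect ((B : set X) !=set0).
  left; apply: closed_set_eq; apply/seteqP; split=> // _ ->.
  by rewrite -(Bx _ By).
right; apply: closed_set_eq => /=; rewrite -subset0 => y By.
by apply: B0; exists y.
Qed.

Definition F_alg (X : topologicalType) (sX : stone_space X) : balg :=
  BAlg (cs_algebraic sX) (cs_countable sX) (cs_boolean sX).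

Section FMap.
Variables (X Y : topologicalType) (sX : stone_space X) (sY : stone_space Y).
Variables (g : X -> set Y) (gP : cv_uhc g).

Definition F_fun (A : F_alg sX) : F_alg sY :=
  ClosedSet (closed_image sX sY gP (csetP A)).

Lemma F_scott : scott_continuous F_fun.
Proof.
move=> D s Ddir Dsup; have [Dub _] := Dsup; split.
  move=> _ [A DA <-]; apply/cs_leP => y [x sx gxy]; exists x => //.
  by have /cs_leP := Dub A DA; exact.
move=> B BD; apply/cs_leP => y By; rewrite (cs_supE Dsup) /=.
have [|x [Dx gxy]] := cs_directed_inter sX Ddir (closed_fiber sY gP (y := y)).
  move=> A DA; have /cs_leP/(_ y By)[x Ax gxy] : F_fun A <= B by apply: BD; exists A.
  by exists x.
by exists x.
Qed.

Lemma F_coatomic : coatomic F_fun.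
Proof.
move=> A; split.
  move=> _ [C [_ /cs_leP AC] <-]; apply/cs_leP => y [x Cx gxy].
  by exists x => //; exact: AC.
move=> B BA; apply/cs_leP => y [x Ax gxy].
have /cs_leP : B <= F_fun (cs_point sX x).
  apply: BA; exists (cs_point sX x) => //; split; first by apply/cs_coatomP; exists x.
  by apply/cs_leP => _ ->.
by apply; exists x.
Qed.

Definition F_map : balg_hom (F_alg sX) (F_alg sY) := BAlgHom F_scott F_coatomic.

End FMap.

Definition F_system (X : SysEFall) : dynAlg :=
  @DynLattice (F_alg (spaceP X)) (F_map (spaceP X) (spaceP X) (dynP X)).

Program Definition F_ef (X Y : SysEFall) (p : hom X Y) :
    hom (F_system X) (F_system Y) :=
  @DynPair (F_system X) (F_system Y)
    (F_map (spaceP X) (spaceP Y) (g := emb p) _)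
    (F_map (spaceP Y) (spaceP X) (g := fac p) _) _.
Next Obligation.
by move=> X Y p; exact: (sm_cv_uhc (embedding_morphism (ef_embedding (ef_pairP p)))).
Qed.
Next Obligation.
by move=> X Y p; exact: (sm_cv_uhc (factor_morphism (ef_factor (ef_pairP p)))).
Qed.
Next Obligation.
move=> X Y p; have [[emor etot einj elift] [fmor fsurj flift] sec ret] := ef_pairP p.
have [h [fh _]] := fsurj.
split.
- move=> b /(cs_coatomP (spaceP Y))[y ->]; apply/(cs_coatomP (spaceP X)); exists (h y).
  by apply: closed_set_eq => /=; rewrite /mf_image bigcup_set1 fh.
- apply: balg_hom_eq => A; apply: closed_set_eq; apply/seteqP; split=> x /=.
    move=> [y [x' Ax' ex'y] fyx].
    by have : mf_comp (fac p) (emb p) x' x by [exists y]; rewrite sec => ->.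
  move=> Ax; have : mf_comp (fac p) (emb p) x x by rewrite sec.
  by move=> [y ey fy]; exists y => //; exists x.
- move=> B; apply/cs_leP => y By /=; have [x fx ex] := ret y.
  by exists x => //; exists y.
- move=> A; apply/cs_leP => x' [x Ax Txx'] /=.
  have [y [y' [xy xy' yy']]] := sm_forth emor Txx'.
  exists y'; first by exists y => //; exists x.
  have [x'' fx'' ex''] := ret y'.
  have [->//|/(einj.1 _ _)] := pselect (x' = x'').
  by rewrite -subset0 => /(_ y')[].
- move=> B; apply/cs_leP => x' [y' [y By Syy'] fx'] /=.
  have [x [x'' [fx fx'' xx'']]] := sm_forth fmor Syy'.
  exists x; first by exists y.
  by have -> : x' = x'' by move: fx' fx''; rewrite fh => -> ->.
Qed.

Program Definition functor_F : functor SysEFall dynAlg :=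
  @Functor SysEFall dynAlg F_system F_ef _ _.
Next Obligation.
move=> X; apply: dyn_pair_eq; apply: balg_hom_eq => A; apply: closed_set_eq;
  by rewrite /= /mf_image; apply/seteqP; split=> [x [_ Ax ->]//|x Ax]; exists x.
Qed.
Next Obligation.
move=> X Y Z q p; apply: dyn_pair_eq; apply: balg_hom_eq => A; apply: closed_set_eq;
  apply/seteqP; split=> z /=.
- by move=> [x Ax [y xy yz]]; exists y => //; exists x.
- by move=> [y [x Ax xy] yz]; exists x => //; exists y.
- by move=> [x Ax [y xy yz]]; exists y => //; exists x.
- by move=> [y [x Ax xy] yz]; exists x => //; exists y.
Qed.

Definition SysEF : category := full_subcategory (C := SysEFall) nontrivial_system.

(* [dynAlg] contains the pairs [(A, alpha)] with [alpha] constantly the top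
   element, that is, up to isomorphism, the images of the systems without any
   transition.  No morphism of [dynAlg] goes from an [(F X, F T)] with [T]
   nontrivial to such a pair, so the essential image of [SysEF] consists of the
   other pairs only. *)
Definition nontrivial_dyn_lattice (A : dynAlg) :=
  exists a : dl_alg A, dl_map A a <> \top.

Definition dynAlg_nontrivial : category := full_subcategory nontrivial_dyn_lattice.

Lemma F_nontrivial (X : SysEFall) :
  nontrivial_system X -> nontrivial_dyn_lattice (functor_F X).
Proof.
move=> [x [x' xx']]; exists \bot => T0.
by have : cset (\top : closed_set X) x' by [rewrite -T0; exists x].
Qed.

Definition functor_F_ef : functor SysEF dynAlg_nontrivial :=
  functor_restrict F_nontrivial.

(* Main.v *)
(* A fully faithful, essentially surjective functor is an equivalence.
   A Scott-continuous co-atomic map [h : F(X) -> F(Y)] is [F(g)] for the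
   multifunction [g] with [g x = h {x}]: upper hemicontinuity of [g] is Scott
   continuity along the clopen neighbourhoods of a point, and co-atomicity says
   that [h] is determined by its values on points.  Under this correspondence
   conditions (1)-(5) translate into those of an ef-pair, with [e x] the fibre
   of [f] over [x].  Conversely, the co-atoms of [A] with the basic open sets
   [{c | k <= c}], [k] compact, form a Stone space whose closed sets are the
   [{c | a <= c}], and every dynamics on [A] transports to it. *)
From HB Require Import structures.
From mathcomp Require Import all_boot all_order.
From mathcomp Require Import boolp classical_sets functions cardinality filter.
From mathcomp Require Import topology.
Require Import Defs.
Set Implicit Arguments.
Unset Strict Implicit.
Unset Printing Implicit Defensive.
Import Order.TTheory.
Local Open Scope order_scope.
Local Open Scope classical_set_scope.

(** * Fully faithful, essentially surjective functors are equivalences *)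

Definition faithful (C D : category) (F : functor C D) :=
  forall (a b : C) (f g : hom a b), fmor F f = fmor F g -> f = g.

Definition full (C D : category) (F : functor C D) :=
  forall (a b : C) (h : hom (F a) (F b)), exists f : hom a b, fmor F f = h.

Definition essentially_surjective (C D : category) (F : functor C D) :=
  forall b : D, exists (a : C) (f : hom (F a) b), is_iso f.

Section FullyFaithful.
Variables (C D : category) (F : functor C D).
Hypotheses (Ffaithful : faithful F) (Ffull : full F).
Hypothesis Fsurj : essentially_surjective F.

Let lift (a b : C) (h : hom (F a) (F b)) : hom a b := sval (cid (Ffull h)).

Let liftK a b (h : hom (F a) (F b)) : fmor F (lift h) = h.
Proof. by rewrite /lift; case: cid. Qed.

Let pre (b : D) : C := sval (cid (Fsurj b)).
Let to (b : D) : hom (F (pre b)) b := sval (cid (svalP (cid (Fsurj b)))).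
Let to_iso b : is_iso (to b) := svalP (cid (svalP (cid (Fsurj b)))).
Let from (b : D) : hom b (F (pre b)) := sval (cid (to_iso b)).

Let fromK b : from b \oc to b = idc _.
Proof. by have [] := svalP (cid (to_iso b)). Qed.

Let toK b : to b \oc from b = idc _.
Proof. by have [] := svalP (cid (to_iso b)). Qed.

(** Conjugation by the chosen isomorphisms [to], lifted along fullness; faithfulness makes the lifts
    functorial. *)
Let inv_mor (b b' : D) (f : hom b b') : hom (pre b) (pre b') :=
  lift (from b' \oc f \oc to b).

Let inv_mor_id b : inv_mor (idc b) = idc (pre b).
Proof. by apply: Ffaithful; rewrite liftK fmor_id comp_idr fromK. Qed.

Let inv_mor_comp b1 b2 b3 (g : hom b2 b3) (f : hom b1 b2) :
  inv_mor (g \oc f) = inv_mor g \oc inv_mor f.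
Proof.
apply: Ffaithful; rewrite fmor_comp !liftK -!comp_assoc.
by rewrite [to b2 \oc _]comp_assoc toK comp_idl.
Qed.

Let inv : functor D C := Functor inv_mor_id inv_mor_comp.

Lemma fully_faithful_surj_equivalence : is_equivalence F.
Proof.
exists inv; split.
- exists (fun a => lift (to (F a))); split=> [a|a b f] /=.
    exists (lift (from (F a))).
    by split; apply: Ffaithful; rewrite fmor_comp !liftK fmor_id ?fromK ?toK.
  apply: Ffaithful; rewrite !fmor_comp !liftK.
  by rewrite !comp_assoc toK comp_idl.
- exists to; split=> [b|b b' f] /=; first exact: to_iso.
  by rewrite liftK !comp_assoc toK comp_idl.
Qed.

End FullyFaithful.

(** * Scott-continuous co-atomic maps as multifunctions *)

Section FMapSurjective.
Variables (X Y : topologicalType) (sX : stone_space X) (sY : stone_space Y).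
Variable h : balg_hom (F_alg sX) (F_alg sY).

(** The only candidate: [F_map] of [g] sends the singleton of [x] to [g x]. *)
Definition pointwise (x : X) : set Y := h (cs_point sX x).

Let hmono := scott_mono (balg_scott h).

Lemma pointwise_cv_uhc : cv_uhc pointwise.
Proof.
split=> [x|x V oV hxV]; first exact: csetP.
pose D := [set A : F_alg sX | clopen (A : set X) /\ A <= cs_point sX x].
have [Ddir Dsup] := cs_clopen_directed sX (cs_point sX x).
have hDdir : directed (h @` D).
  have [[A DA] Dub] := Ddir; split; first by exists (h A); exists A.
  move=> _ _ [B DB <-] [C DC <-]; have [E DE [BE CE]] := Dub _ _ DB DC.
  by exists (h E); [exists E|split; exact: hmono].
have hDsup := balg_scott h Ddir Dsup.
(* Compactness of [Y]: if every [h A] met the complement of [V], so would their directed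
   intersection, which is [h {x}] by Scott continuity. *)
have [A [[oA _] Ax] hAV] : exists2 A, D A & (h A : set Y) `<=` V.
  apply: contrapT => noA.
  have [||y [hy nVy]] := cs_directed_inter sY (C := ~` V) hDdir.
  - exact: open_closedC.
  - move=> _ [A DA <-]; apply: contrapT => hA; apply: noA; exists A => // y hAy.
    by apply: contrapT => nVy; apply: hA; exists y.
  by apply: nVy; apply: hxV; rewrite /pointwise (cs_supE hDsup).
exists (A : set X); first by split=> //; move/cs_leP: Ax; exact.
move=> x' Ax' y hx'y; apply: hAV.
have /hmono/cs_leP : A <= cs_point sX x' by apply/cs_leP => _ ->.
exact.
Qed.

(** Co-atomicity gives the first inequality, as co-atoms are singletons; monotonicity gives the
    second. *)
Lemma F_map_pointwise (gP : cv_uhc pointwise) : F_map sX sY gP = h.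
Proof.
apply: balg_hom_eq => A; apply/eqP; rewrite eq_le; apply/andP; split.
  have [_ glb] := balg_coatomic h A; apply: glb => _ [B [/cs_coatomP cB AB] <-].
  have [x Bx] := cB sX; subst B; apply/cs_leP => y hxy; exists x => //.
  by move/cs_leP: AB; exact.
apply/cs_leP => y [x Ax hxy].
by have /hmono/cs_leP : A <= cs_point sX x by [apply/cs_leP => _ ->]; exact.
Qed.

End FMapSurjective.

Lemma F_map_inj (X Y : topologicalType) (sX : stone_space X) (sY : stone_space Y)
    (g g' : X -> set Y) (gP : cv_uhc g) (gP' : cv_uhc g') :
  F_map sX sY gP = F_map sX sY gP' -> g = g'.
Proof.
move=> gg'; apply/funext => x.
have /(congr1 (@cset Y)) : F_map sX sY gP (cs_point sX x) = F_map sX sY gP' (cs_point sX x).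
  by rewrite gg'.
by rewrite /= /mf_image !bigcup_set1.
Qed.

Lemma F_faithful : faithful functor_F.
Proof.
move=> X Y p q pq; apply: ef_pair_eq.
  exact: F_map_inj (congr1 (@dp_eps _ _) pq).
exact: F_map_inj (congr1 (@dp_pi _ _) pq).
Qed.

(** * Fullness: from lattice pairs to ef-pairs *)

Section DynPairEFPair.
Variables (X Y : system) (p : dyn_pair (F_system X) (F_system Y)).

Definition pair_emb := pointwise (dp_eps p).
Definition pair_fac := pointwise (dp_pi p).

Let e_uhc : cv_uhc pair_emb := pointwise_cv_uhc (dp_eps p).
Let f_uhc : cv_uhc pair_fac := pointwise_cv_uhc (dp_pi p).

Lemma pair_epsE A : cset (dp_eps p A) = mf_image pair_emb A.
Proof. by rewrite -(F_map_pointwise e_uhc). Qed.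

Lemma pair_piE A : cset (dp_pi p A) = mf_image pair_fac A.
Proof. by rewrite -(F_map_pointwise f_uhc). Qed.

(** Condition (1), since the co-atoms are the singletons. *)
Lemma pair_facE y : exists x, pair_fac y = [set x].
Proof.
have /(dp_coatom (dyn_pairP p)) : coatom (cs_point (spaceP Y) y).
  by apply/(cs_coatomP (spaceP Y)); exists y.
by move=> /(cs_coatomP (spaceP X))[x ex]; exists x; rewrite /pair_fac /pointwise ex.
Qed.

Lemma pair_section x : mf_comp pair_fac pair_emb x = [set x].
Proof.
have /(congr1 (fun g : balg_hom (F_alg (spaceP X)) (F_alg (spaceP X)) =>
    cset (g (cs_point (spaceP X) x)))) :=
  dp_section (dyn_pairP p).
by rewrite /= pair_piE pair_epsE /mf_comp /mf_image [in X in X = _]bigcup_set1.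
Qed.

Lemma pair_retract y : mf_comp pair_emb pair_fac y y.
Proof.
have /cs_leP/(_ y erefl) := dp_retract (dyn_pairP p) (cs_point (spaceP Y) y).
by rewrite /= pair_epsE pair_piE /mf_comp /mf_image bigcup_set1.
Qed.

(** Condition (4) at the singleton of [x]; the order being reverse inclusion, the right-hand side is
    contained in the left. *)
Lemma pair_lower (x x' : X) : dyn x x' ->
  exists y y' : Y, [/\ pair_emb x y, dyn y y' & pair_fac y' x'].
Proof.
move=> xx'; have /cs_leP/(_ x') := dp_lower (dyn_pairP p) (cs_point (spaceP X) x).
rewrite /= pair_piE /= pair_epsE /mf_image !bigcup_set1.
by move=> /(_ xx')[y' [y xy yy'] y'x']; exists y, y'.
Qed.

(** Condition (5) at the singleton of [y], read as an inclusion in the same way. *)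
Lemma pair_upper (y y' : Y) (x' : X) : dyn y y' -> pair_fac y' x' ->
  exists2 x, pair_fac y x & dyn x x'.
Proof.
move=> yy' y'x'; have /cs_leP/(_ x') := dp_upper (dyn_pairP p) (cs_point (spaceP Y) y).
rewrite /= !pair_piE /= /mf_image !bigcup_set1.
by case=> [|x yx xx']; [exists y'|exists x].
Qed.

(** As [pair_fac] is single-valued, (2) puts [pair_emb x] inside the fibre over [x], and (3) gives
    the converse. *)
Lemma pair_embE x y : pair_emb x y <-> pair_fac y x.
Proof.
split=> [xy|yx].
  have [x' fy] := pair_facE y; rewrite fy.
  have : mf_comp pair_fac pair_emb x x' by exists y => //; rewrite fy.
  by rewrite pair_section.
have [x'] := pair_retract y; have [x'' fy] := pair_facE y.
by move: yx; rewrite fy => -> ->.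
Qed.

Lemma dyn_pair_ef : is_ef_pair (X := X) (Y := Y) pair_emb pair_fac.
Proof.
(* Condition (5) started from the unique image of [y']. It serves as (ii) for the embedding and (i)
   for the factor and, the image of [y] being unique, yields both lifting properties. *)
have down (y y' : Y) : dyn y y' ->
    exists x x' : X, [/\ pair_fac y x, pair_fac y' x' & dyn x x'].
  move=> yy'; have [x' fy'] := pair_facE y'.
  have y'x' : pair_fac y' x' by rewrite fy'.
  by have [x yx xx'] := pair_upper yy' y'x'; exists x, x'.
have facU y x x' : pair_fac y x -> pair_fac y x' -> x = x'.
  by have [z ->] := pair_facE y => -> ->.
have tot x : exists y, pair_emb x y.
  have : mf_comp pair_fac pair_emb x x by rewrite pair_section.
  by case=> y xy _; exists y.
split; [split|split|exact: pair_section|exact: pair_retract].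
- split; [exact: e_uhc|move=> x x' /pair_lower[y [y' [xy yy' y'x']]]|
      move=> y y' /down[x [x' [yx y'x' xx']]]].
    by exists y, y'; split=> //; apply/pair_embE.
  by exists x, x'; split=> //; apply/pair_embE.
- exact: tot.
- split=> [x x' xx'|y]; last by have [x _ xy] := pair_retract y; exists x.
  rewrite -subset0 => y [/pair_embE yx /pair_embE yx']; apply: xx'; exact: facU yx yx'.
- move=> x y y' /pair_embE yx /down[x1 [x' [yx1 y'x' xx']]].
  by exists x'; [rewrite (facU _ _ _ yx yx1)|apply/pair_embE].
- split; [exact: f_uhc|move=> y y' /down[x [x' [yx y'x' xx']]]|
      move=> x x' /pair_lower[y [y' [xy yy' y'x']]]].
    by exists x, x'.
  by exists y, y'; split=> //; apply/pair_embE.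
- exists (fun y => sval (cid (pair_facE y))); split=> [y|x]; first by case: cid.
  have [y /pair_embE yx] := tot x; exists y; case: cid => x' /= fy.
  by move: yx; rewrite fy.
- move=> y y' x yx /down[x1 [x' [yx1 y'x' xx']]].
  by exists x' => //; rewrite (facU _ _ _ yx yx1).
Qed.

End DynPairEFPair.

Lemma F_full : full functor_F.
Proof.
move=> X Y p; exists (EFPair (dyn_pair_ef p)).
by apply: dyn_pair_eq; exact: F_map_pointwise.
Qed.

(** * Order isomorphisms are morphisms of the category of lattices *)

Section OrderIso.
Variables (A B : balg) (phi : A -> B) (psi : B -> A).
Hypothesis (phiK : cancel phi psi) (psiK : cancel psi phi).
Hypothesis phi_le : {mono phi : x y / x <= y}.

Let psi_le : {mono psi : x y / x <= y}.
Proof. by move=> x y; rewrite -phi_le !psiK. Qed.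

Lemma order_iso_scott : scott_continuous phi.
Proof.
move=> D s _ [Dub Dlub]; split=> [_ [x Dx <-]|z zub].
  by rewrite phi_le; exact: Dub.
rewrite -[z]psiK phi_le; apply: Dlub => x Dx.
by rewrite -phi_le psiK; apply: zub; exists x.
Qed.

Lemma order_iso_coatom x : coatom x -> coatom (phi x).
Proof.
move=> [x1 xmax]; have phi1 : phi \top = \top.
  by apply/eqP; rewrite -le1x -[\top]psiK phi_le lex1.
split=> [/(congr1 psi)|y]; first by rewrite phiK -phi1 phiK.
by rewrite -[y]psiK phi_le => /xmax[->|->]; [left|right].
Qed.

(** By [coatom_inf] each element is the meet of the co-atoms above it, and an order isomorphism
    preserves meets. *)
Lemma order_iso_coatomic : coatomic phi.
Proof.
move=> x; split=> [_ [c [_ xc] <-]|z zlb]; first by rewrite phi_le.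
rewrite -[z]psiK phi_le; have [_ glb] := coatom_inf x; apply: glb => c xc.
by rewrite -phi_le psiK; apply: zlb; exists c.
Qed.

Definition order_iso_hom : balg_hom A B :=
  BAlgHom order_iso_scott order_iso_coatomic.

End OrderIso.

(** * The Stone space of co-atoms and its closed sets *)

Definition coatom_space (A : balg) := {c : A | coatom c}.

Section CoatomSpace.
Variable A : balg.
Implicit Types (a b k n : A) (c : coatom_space A).

Local Notation K := (@compact_element _ A).

(** A co-atom [c] stands for the prime ideal of the compact [k <= c]; for compact [k], [hull k] is
    thus a basic clopen set of Stone duality. *)
Definition hull a : set (coatom_space A) := [set c | a <= sval c].

Definition hull_open (U : set (coatom_space A)) :=
  forall c, U c -> exists k, [/\ K k, hull k c & hull k `<=` U].

Lemma coatom_space_inj c c' : sval c = sval c' -> c = c'.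
Proof. by case: c c' => [c cc] [c' cc'] /= e; exact: eq_exist. Qed.

Lemma hull_join a b : hull (a `|` b)%O = hull a `&` hull b.
Proof.
by apply/seteqP; split=> c; rewrite /hull /= leUx => /andP.
Qed.

Lemma hull_openT : hull_open setT.
Proof. by move=> c _; exists \bot; split=> //; [exact: compact_bot|exact: le0x]. Qed.

Lemma hull_openI : setI_closed hull_open.
Proof.
move=> U V oU oV c [/oU[k [Kk kc kU]] /oV[n [Kn nc nV]]].
exists (k `|` n)%O; rewrite hull_join; split=> //; first exact: compact_join.
exact: setISS.
Qed.

Lemma hull_open_bigU (I : Type) (f : I -> set (coatom_space A)) :
  (forall i, hull_open (f i)) -> hull_open (\bigcup_i f i).
Proof.
move=> fo c [i _ /fo[k [Kk kc kf]]]; exists k; split=> // c' /kf fc'.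
by exists i.
Qed.

HB.instance Definition _ := gen_eqMixin (coatom_space A).
HB.instance Definition _ := gen_choiceMixin (coatom_space A).
HB.instance Definition _ := isOpenTopological.Build (coatom_space A)
  hull_openT hull_openI hull_open_bigU.

Lemma hull_openE (U : set (coatom_space A)) : open U = hull_open U.
Proof. by []. Qed.

Lemma coatom_proper c : ~ \top <= sval c.
Proof. by rewrite le1x => /eqP; exact: (svalP c).1. Qed.

(** A co-atom is prime, so it lies above [k] or [n]; it is not [\top], so not above both. *)
Lemma hull_compl k n : (k `&` n)%O = \bot -> (k `|` n)%O = \top -> hull n = ~` hull k.
Proof.
move=> kn0 kn1; apply/seteqP; split=> c /= nc => [kc|].
  by apply: (@coatom_proper c); rewrite -kn1 leUx; apply/andP.
have [|//|//] := coatom_prime (svalP c) (x := k) (y := n).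
by rewrite kn0; exact: le0x.
Qed.

Lemma hull_compact_compl k : K k -> exists2 n, K n & hull n = ~` hull k.
Proof.
move=> Kk; have [_ /(_ k Kk)[n Kn [kn0 kn1]]] := compact_top_compl A.
by exists n => //; exact: hull_compl.
Qed.

Lemma open_hull k : K k -> open (hull k).
Proof. by move=> Kk; rewrite hull_openE => c kc; exists k; split. Qed.

Lemma clopen_hull k : K k -> clopen (hull k).
Proof.
move=> Kk; split; first exact: open_hull.
by have [n Kn nk] := hull_compact_compl Kk; rewrite -openC -nk; exact: open_hull.
Qed.

Lemma hull_nbhs c (U : set (coatom_space A)) :
  nbhs c U -> exists k, [/\ K k, hull k c & hull k `<=` U].
Proof.
rewrite nbhsE => -[V [+ Vc] VU]; rewrite hull_openE => oV; have [k [Kk kc kV]] := oV c Vc.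
by exists k; split=> //; exact: subset_trans VU.
Qed.

Lemma hull_basis : basis (hull @` K).
Proof.
split=> [_ [k Kk <-]|c U /hull_nbhs[k [Kk kc kU]]]; first exact: open_hull.
by exists (hull k) => //; split=> //; exists k.
Qed.

Lemma compact_separation a c : ~ hull a c ->
  exists k, [/\ K k, k <= a & ~ hull k c].
Proof.
move=> ac; apply: contrapT => noK; apply: ac; apply: compact_le => k Kk ka.
by apply: contrapT => kc; apply: noK; exists k.
Qed.

(** As [a] is the join of the compact elements below it, [hull a] is an intersection of clopen
    hulls. *)
Lemma closed_hull a : closed (hull a).
Proof.
rewrite -openC hull_openE => c /compact_separation[k [Kk ka kc]].
have [n Kn nk] := hull_compact_compl Kk.
exists n; rewrite nk; split=> // c' kc' ac'; apply: kc'; exact: le_trans ac'.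
Qed.

Lemma hull_le a b : hull b `<=` hull a -> a <= b.
Proof.
move=> ba; have [_ glb] := coatom_inf b; apply: glb => c [cc bc].
exact: (ba (exist _ c cc)).
Qed.

(* A filter clusters at any co-atom above the join of the compact [k] whose
   basic open set belongs to it; this join is not [\top] as [\top] is compact. *)
Lemma coatom_space_compact : compact [set: coatom_space A].
Proof.
move=> F FF _; have [Ktop _] := compact_top_compl A.
pose D := [set k | K k /\ F (hull k)].
have Ddir : directed D.
  split.
    exists \bot; split; first exact: compact_bot.
    by apply: filterS filterT => c _; exact: le0x.
  move=> k n [Kk Fk] [Kn Fn]; exists (k `|` n)%O; last by split; [exact: leUl|exact: leUr].
  by split; [exact: compact_join|rewrite hull_join; exact: filterI].
have [s Dsup] := (balg_algebraic A).1 _ Ddir.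
have [s1|/coatom_above[c [cc sc]]] := pselect (s = \top).
  have [k [_ Fk] k1] : exists2 k, D k & \top <= k by apply: Ktop Ddir Dsup _; rewrite s1.
  by have [c kc] := filter_ex Fk; case: (@coatom_proper c); exact: le_trans kc.
exists (exist _ c cc); split=> // W V FW /hull_nbhs[k [Kk kc kV]].
apply: contrapT => WV; have [n Kn nk] := hull_compact_compl Kk.
have /Dsup.1 ns : D n.
  split=> //; apply: filterS FW => c' Wc'; rewrite nk => kc'; apply: WV; exists c'.
  by split=> //; exact: kV.
have : hull n (exist _ c cc) by exact: le_trans sc.
by rewrite nk; exact.
Qed.

(** Distinct co-atoms are incomparable, so some compact [k] lies below one only; the hulls of [k]
    and of its complement separate them. *)
Lemma coatom_space_hausdorff : hausdorff_space (coatom_space A).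
Proof.
move=> c c' cc'; apply: contrapT => c_neq.
have [|k [Kk kc kc']] := @compact_separation (sval c) c'.
  move=> /((svalP c).2)[c'E|c'1]; last exact: (svalP c').1.
  by apply: c_neq; exact: coatom_space_inj.
have [n Kn nk] := hull_compact_compl Kk.
have [||c'' [+]] := cc' (hull k) (hull n); last by rewrite nk.
- by apply: open_nbhs_nbhs; split=> //; exact: open_hull.
- by apply: open_nbhs_nbhs; split; [exact: open_hull|rewrite nk].
Qed.

Lemma coatom_space_stone : stone_space (coatom_space A).
Proof.
split.
- exists (hull @` K); last exact: hull_basis.
  by move=> _ [k Kk <-]; exact: clopen_hull.
- exists (hull @` K); last exact: hull_basis.
  exact/card_le_trans/(balg_countable A)/card_image_le.
- exact: coatom_space_compact.
- exact: coatom_space_hausdorff.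
Qed.

(** Take for [a] the join of the compact [k] whose hull contains [C]. A point outside [C] has a
    basic neighbourhood [hull k] missing [C], and then the complement of [k] is among the elements
    joined. *)
Lemma closed_hullP (C : set (coatom_space A)) : closed C -> exists a, hull a = C.
Proof.
rewrite -openC hull_openE => oC; pose D := [set k | K k /\ C `<=` hull k].
have Ddir : directed D.
  split; first by exists \bot; split; [exact: compact_bot|move=> c _; exact: le0x].
  move=> k n [Kk Ck] [Kn Cn]; exists (k `|` n)%O; last by split; [exact: leUl|exact: leUr].
  by split; [exact: compact_join|rewrite hull_join subsetI].
have [a [Dub Dlub]] := (balg_algebraic A).1 _ Ddir; exists a.
apply/seteqP; split=> c; last by move=> Cc; apply: Dlub => k [_]; exact.
move=> ac; apply: contrapT => /oC[k [Kk kc kC]].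
have [n Kn nk] := hull_compact_compl Kk.
have /Dub na : D n by split=> // c' Cc'; rewrite nk => /kC; exact.
have : hull n c by exact: le_trans ac.
by rewrite nk; exact.
Qed.

Local Notation F := (F_alg coatom_space_stone).

Definition hull_set a : F := ClosedSet (@closed_hull a).
Definition hull_inf (C : F) : A := sval (cid (closed_hullP (csetP C))).

Lemma hull_infK : cancel hull_inf hull_set.
Proof. by move=> C; apply: closed_set_eq; rewrite /hull_inf /=; case: cid. Qed.

Lemma hull_set_le : {mono hull_set : a b / a <= b}.
Proof.
move=> a b; apply/cs_leP/idP => [|ab c]; first exact: hull_le.
exact: le_trans.
Qed.

Lemma hull_setK : cancel hull_set hull_inf.
Proof. by move=> a; apply: (inc_inj hull_set_le); exact: hull_infK. Qed.

Lemma hull_inf_le : {mono hull_inf : B C / B <= C}.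
Proof. by move=> B C; rewrite -hull_set_le !hull_infK. Qed.

Definition hull_hom : balg_hom A F := order_iso_hom hull_infK hull_set_le.
Definition hull_inv : balg_hom F A := order_iso_hom hull_setK hull_inf_le.

End CoatomSpace.

(** * Essential surjectivity and the equivalences *)

Lemma F_surj : essentially_surjective functor_F.
Proof.
move=> [A alpha]; pose phi := hull_hom A; pose psi := hull_inv A.
have phiK : cancel phi psi by exact: hull_setK.
have psiK : cancel psi phi by exact: hull_infK.
(* [alpha] transported to the closed sets of the co-atom space; its [pointwise] multifunction is the
   dynamics. *)
pose h := balg_comp phi (balg_comp alpha psi).
pose S := coatom_space_stone A.
pose X : system := System S (pointwise_cv_uhc h).
have hE C : dl_map (F_system X) C = phi (alpha (psi C)).
  exact: (congr1 (fun g : balg_hom (F_alg S) (F_alg S) => g C)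
    (F_map_pointwise (pointwise_cv_uhc h))).
exists X.
(* Since [phi] and [psi] are mutually inverse and intertwine the dynamics, (3)-(5) hold with
   equality in both directions. *)
have pP : @is_dyn_pair (F_system X) (DynLattice alpha) psi phi.
  split.
  - exact: order_iso_coatom (@hull_setK A) (@hull_infK A) (@hull_set_le A).
  - exact/balg_hom_eq/psiK.
  - by move=> a; change (psi (phi a) <= a); rewrite phiK.
  - by move=> C; rewrite hE.
  - move=> a; change (dl_map (F_system X) (phi a) <= phi (alpha a)).
    by rewrite hE phiK.
have qP : @is_dyn_pair (DynLattice alpha) (F_system X) phi psi.
  split.
  - exact: order_iso_coatom (@hull_infK A) (@hull_setK A) (@hull_inf_le A).
  - exact/balg_hom_eq/phiK.
  - by move=> C; change (phi (psi C) <= C); rewrite psiK.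
  - move=> a; change (psi (dl_map (F_system X) (phi a)) <= alpha a).
    by rewrite hE !phiK.
  - move=> C; change (alpha (psi C) <= psi (dl_map (F_system X) C)).
    by rewrite hE phiK.
exists (DynPair pP), (DynPair qP).
by split; apply: dyn_pair_eq; apply: balg_hom_eq; first [exact: phiK|exact: psiK].
Qed.

(** Without transitions [F(T)] is constantly [\top], which [dp_pi p] preserves, so (4) forces
    [dl_map B] to be constantly [\top]. *)
Lemma F_nontrivial_reflect (X : system) (B : dyn_lattice) :
  dyn_pair B (F_system X) -> nontrivial_dyn_lattice B -> nontrivial_system X.
Proof.
move=> p [b b1]; apply: contrapT => X0; apply: b1; apply/eqP; rewrite -le1x.
(* A monotone map with a section reaches [\top], hence fixes it. *)
have piT : dp_pi p \top = \top.
  have pK a : dp_pi p (dp_eps p a) = a.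
    exact: (congr1 (fun g : balg_hom (dl_alg B) (dl_alg B) => g a) (dp_section (dyn_pairP p))).
  apply/eqP; rewrite -le1x -[X in X <= _]pK.
  by apply: (scott_mono (balg_scott (dp_pi p))); exact: lex1.
apply: le_trans (dp_lower (dyn_pairP p) b); rewrite -piT.
apply: (scott_mono (balg_scott (dp_pi p))); apply/cs_leP => x' [x _ xx'].
by case: X0; exists x, x'.
Qed.

Theorem theorem5p1 :
  is_equivalence functor_F_ef /\ is_equivalence functor_F.
Proof.
split; apply: fully_faithful_surj_equivalence.
(* Full subcategories keep all morphisms; only essential surjectivity has to return to nontrivial
   systems. *)
- by move=> X Y; exact: F_faithful.
- by move=> X Y; exact: F_full.
- move=> [B B1]; have [X [p [q [qp pq]]]] := F_surj B.
  by exists (exist _ X (F_nontrivial_reflect q B1)), p, q.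
- exact: F_faithful.
- exact: F_full.
- exact: F_surj.
Qed.
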